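(* Let $K$ be an algebraically closed field, let $\lambda$ be a partition and let $V$ be a finite-dimensional bigraded $K$-vector space of shape $\lambda$, i.e. $\lambda(V)=\lambda$. Suppose that $\underline{\dim}V$ contains a minimal nullroot, i.e. there is a partition $\mu$ with $\mathcal{Q}(\mu)_0\subseteq\mathcal{Q}(\lambda)_0$ and $\mathcal{A}(\mu)$ tame such that $\dim V_{i,j}\ge(\delta_\mu)_{i,j}$ for all $(i,j)\in\mathcal{Q}(\mu)_0$, where $\delta_\mu$ is the minimal positive nullroot of $q_\mu$. Then the number of graded nilpotent pairs on $V$ up to isomorphism (i.e. the number of $\prod_{s,t}\mathrm{GL}(V_{s,t})$-orbits of such pairs) is infinite.
   Context: Partitions are written as increasing sequences $\lambda=(\lambda_1\le\dots\le\lambda_l)$ of positive integers; exponents denote repetition. Put $\mathcal{Q}(\lambda)_0=\{(i,j)\mid 1\le i\le l,\ 1\le j\le\lambda_{l+1-i}\}$ (the boxes of the Young diagram). A bigraded vector space is $V=\bigoplus_{s,t\in\mathbb{Z}_{\ge1}}V_{s,t}$, with $V_{x,y}:=0$ for $(x,y)\notin\mathbb{Z}_{\ge1}^2$. A graded nilpotent pair on $V$ is a pair $(\varphi,\psi)$ of commuting nilpotent endomorphisms of $V$ with $\varphi(V_{s,t})\subseteq V_{s-1,t}$ and $\psi(V_{s,t})\subseteq V_{s,t-1}$. The group $\prod_{s,t}\mathrm{GL}(V_{s,t})$ acts by simultaneous conjugation. The shape of $V$ is $\mathrm{sh}(V)=\{(s,t)\mid\exists\,p\ge s,\ q\ge t:\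 V_{p,q}\ne0\}$, and $\lambda(V)$ is the partition with $\mathrm{sh}(V)=\mathcal{Q}(\lambda(V))_0$. $\underline{\dim}V=(\dim V_{i,j})_{(i,j)\in\mathcal{Q}(\lambda)_0}$. The staircase algebra $\mathcal{A}(\mu)$ is the path algebra of the quiver with vertex set $\mathcal{Q}(\mu)_0$ and arrows $(i,j)\to(i-1,j)$ and $(i,j)\to(i,j-1)$ (whenever both vertices exist), modulo all commutativity relations of its squares. Its Tits form is, for $x\in\mathbb{Z}^{\mathcal{Q}(\mu)_0}$, $$q_\mu(x)=\sum_{(i,j)}x_{i,j}^2-\sum_{(i,j),\,i\ge2}x_{i,j}x_{i-1,j}-\sum_{(i,j),\,j\ge2}x_{i,j}x_{i,j-1}+\sum_{(i,j),\,i,j\ge2}x_{i,j}x_{i-1,j-1},$$ sums over $(i,j)\in\mathcal{Q}(\mu)_0$. The algebra $\mathcal{A}(\mu)$ is tame (and representation-infinite) exactly for $\mu$ in the list $(3,6)$, $(1,2,6)$, $(1,3,4)$, $(2^2,5)$, $(1^2,2,4)$, $(1,2^2,3)$, $(1^3,3^2)$, $(1^3,2^3)$, $(1^4,2,3)$, $(4,5)$, $(5^2)$, $(1,4^2)$, $(2,3^2)$, $(3^3)$, $(2^3,3)$, $(1,2^4)$, $(2^5)$. For such $\mu$, the minimal positive nullroot $\delta_\mu$ is the minimal non-zero vector with non-negative integer entries satisfying $q_\mu(\delta_\mu)=0$ (all such vectors are positive multiples of it). *)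

(* Defs.v *)
From HB Require Import structures.
From mathcomp Require Import all_boot all_order all_algebra.
From mathcomp Require Import mathcomp_extra boolp classical_sets functions.
From mathcomp Require Import cardinality.
Set Implicit Arguments.
Unset Strict Implicit.
Unset Printing Implicit Defensive.
Import Order.TTheory GRing.Theory Num.Theory.
Local Open Scope ring_scope.

Definition is_partition (lam : seq nat) : bool :=
  sorted leq lam && all (leq 1) lam.

(* The boxes Q(lam)_0, with 1-based coordinates.  The part lambda_(l+1-i) of
   the paper's 1-based numbering is [nth 0 lam (l - i)]. *)
Definition boxes (lam : seq nat) : seq (nat * nat) :=
  [seq (i, j) | i <- iota 1 (size lam),
                j <- iota 1 (nth 0%N lam (size lam - i))].

(* Only the values of [x] on [boxes mu] matter: each (i, j) in the diagram with
   i >= 2 (resp. j >= 2) has (i-1, j) (resp. (i, j-1)) in the diagram. *)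
Definition tits_form (mu : seq nat) (x : nat * nat -> int) : int :=
  \sum_(p <- boxes mu) x p ^+ 2
  - \sum_(p <- boxes mu | (2 <= p.1)%N) x p * x (p.1.-1, p.2)
  - \sum_(p <- boxes mu | (2 <= p.2)%N) x p * x (p.1, p.2.-1)
  + \sum_(p <- boxes mu | (2 <= p.1)%N && (2 <= p.2)%N)
      x p * x (p.1.-1, p.2.-1).

(* Non-zero vectors of Z^(boxes mu) with non-negative entries on which the Tits
   form vanishes. *)
Definition positive_nullroot (mu : seq nat) (x : nat * nat -> int) : Prop :=
  [/\ forall p, p \in boxes mu -> 0 <= x p,
      exists2 p, p \in boxes mu & x p != 0
    & tits_form mu x = 0].

(* Minimality is for the componentwise order on Z^(boxes mu). *)
Definition minimal_nullroot (mu : seq nat) (delta : nat * nat -> int) : Prop :=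
  positive_nullroot mu delta /\
  forall x, positive_nullroot mu x ->
    (forall p, p \in boxes mu -> x p <= delta p) ->
    forall p, p \in boxes mu -> x p = delta p.

(* The partitions mu whose staircase algebra A(mu) is tame and
   representation-infinite; tameness enters only through this classification. *)
Definition tame_partitions : seq (seq nat) :=
  [:: [:: 3; 6]; [:: 1; 2; 6]; [:: 1; 3; 4]; [:: 2; 2; 5]; [:: 1; 1; 2; 4];
      [:: 1; 2; 2; 3]; [:: 1; 1; 1; 3; 3]; [:: 1; 1; 1; 2; 2; 2];
      [:: 1; 1; 1; 1; 2; 3]; [:: 4; 5]; [:: 5; 5]; [:: 1; 4; 4]; [:: 2; 3; 3];
      [:: 3; 3; 3]; [:: 2; 2; 2; 3]; [:: 1; 2; 2; 2; 2];
      [:: 2; 2; 2; 2; 2]]%N.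

(* An internal direct sum decomposition of V indexed by pairs of positive
   integers, extended by 0 to the pairs with a zero coordinate. *)
Record bigrading (K : fieldType) (V : vectType K) := Bigrading {
  piece :> nat * nat -> {vspace V};
  piece_eq0 : forall s t, (s == 0)%N || (t == 0)%N -> piece (s, t) = 0%VS;
  piece_direct : forall n,
    directv (\sum_(p : 'I_n * 'I_n) piece (val p.1, val p.2))%VS;
  piece_full : exists n,
    (\sum_(p : 'I_n * 'I_n) piece (val p.1, val p.2))%VS = fullv }.

Section GradedNilpotentPairs.
Variables (K : fieldType) (V : vectType K) (gr : bigrading V).

Definition in_shape (p : nat * nat) : Prop :=
  [/\ (1 <= p.1)%N, (1 <= p.2)%N
    & exists q, [/\ (p.1 <= q.1)%N, (p.2 <= q.2)%N & gr q <> 0%VS]].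

Definition has_shape (lam : seq nat) : Prop :=
  is_partition lam /\ forall p, in_shape p <-> p \in boxes lam.

Definition contains_minimal_nullroot (lam : seq nat) : Prop :=
  exists (mu : seq nat) (delta : nat * nat -> int),
    [/\ is_partition mu, {subset boxes mu <= boxes lam},
        mu \in tame_partitions, minimal_nullroot mu delta
      & forall p, p \in boxes mu -> delta p <= (\dim (gr p))%:Z].

Definition nilpotent_end (f : 'End(V)) : Prop :=
  exists n, forall v, iter n f v = 0.

Definition graded_nilpotent_pair (c : 'End(V) * 'End(V)) : Prop :=
  [/\ (c.1 \o c.2 = c.2 \o c.1)%VF, nilpotent_end c.1, nilpotent_end c.2,
      forall s t, (c.1 @: gr (s.+1, t) <= gr (s, t))%VS
    & forall s t, (c.2 @: gr (s, t.+1) <= gr (s, t))%VS].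

(* The elements of prod_(s,t) GL(V_(s,t)), as automorphisms of V. *)
Definition graded_aut (g : 'End(V)) : Prop :=
  lker g = 0%VS /\ forall p, (g @: gr p)%VS = gr p.

Definition conj_orbit (c : 'End(V) * 'End(V)) : set ('End(V) * 'End(V)) :=
  [set d | exists2 g, graded_aut g &
     d = ((g \o c.1 \o g^-1)%VF, (g \o c.2 \o g^-1)%VF)]%classic.

Definition graded_nilpotent_orbits : set (set ('End(V) * 'End(V))) :=
  [set conj_orbit c | c in [set c | graded_nilpotent_pair c]]%classic.

End GradedNilpotentPairs.

(* Main.v *)
(* Each of the forms [q_mu] is positive semidefinite, and its positive nullroots
   are the multiples of a single vector [h], which is, up to transposition and
   extension by zero, one of seven vectors. For each of these we choose an arrow
   [p -> q] with [h p = 1] and [h q = 2], and integral matrices for all other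
   arrows, such that over every field the endomorphisms of the representation
   they define act as scalars at [q]. The column [(1, t)] on [p -> q] completes
   it to a representation [M_t]. A homomorphism from [M_t] to [M_s] acts at [q]
   by a scalar that takes [(1, t)] to a multiple of [(1, s)], so it vanishes at
   [p] unless [t = s].

   If the dimensions of the pieces of [V] are at least [h], extend [M_t] by zero
   to a pair on [V]. An isomorphism between the pairs for [t] and [s] induces a
   homomorphism from [M_t] to [M_s]; if it vanished at [p], the isomorphism would
   take a generator of the line at [p] into the part of [V] on which the pair for
   [s] acts by zero, although the arrow [p -> q] does not kill it. *)

Require Import Defs.
From HB Require Import structures.
From mathcomp Require Import all_boot all_order all_algebra.
From mathcomp Require Import mathcomp_extra boolp classical_sets functions.
From mathcomp Require Import cardinality.
From mathcomp Require Import zify ring.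
Set Implicit Arguments.
Unset Strict Implicit.
Unset Printing Implicit Defensive.
Import Order.TTheory GRing.Theory Num.Theory.
Local Open Scope ring_scope.

(** * Projections, coordinates and nilpotency in a bigraded space *)

Definition lower (b : bool) (p : nat * nat) : nat * nat :=
  if b then (p.1, p.2.-1) else (p.1.-1, p.2).

Section GradedLinearMaps.
Variables (K : fieldType) (V : vectType K) (gr : bigrading V).

Lemma piece_full_above m : exists2 n, (m <= n)%N &
  (\sum_(p : 'I_n * 'I_n) gr (val p.1, val p.2))%VS = fullv.
Proof.
have [n gr_n] := piece_full gr; exists (maxn m n); first exact: leq_maxl.
apply/eqP; rewrite eqEsubv subvf -gr_n; apply/subv_sumP => -[i j] _.
have le_n := leq_maxr m n.
exact: (@sumv_sup _ _ _ (widen_ord le_n i, widen_ord le_n j)).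
Qed.

Lemma eq_on_pieces (f g : 'End(V)) :
  (forall p v, v \in gr p -> f v = g v) -> f = g.
Proof.
move=> fg; apply/lfunP => v.
have [n _ gr_n] := piece_full_above 0.
have /memv_sumP[w gr_w ->] : v \in (\sum_(p : 'I_n * 'I_n) gr (val p.1, val p.2))%VS.
  by rewrite gr_n memvf.
by rewrite !linear_sum; apply: eq_bigr => p _; exact: fg (gr_w p isT).
Qed.

Lemma piece_projections (m : nat) : exists pi : nat * nat -> 'End(V),
  forall p, (p.1 < m)%N -> (p.2 < m)%N ->
  (forall v, v \in gr p -> pi p v = v) /\
  (forall q v, v \in gr q -> p != q -> pi p v = 0).
Proof.
have [n le_mn gr_n] := piece_full_above m.
pose I : finType := ('I_n * 'I_n)%type.
pose pi0 (p : I) : 'End(V) := sumv_pi_for (esym gr_n) p.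
pose pi (p : nat * nat) : 'End(V) :=
  if (insub p.1, insub p.2) is (Some i, Some j) then pi0 (i, j) else 0.
have sum_pi0 v : \sum_(q : I) pi0 q v = v by apply: sumv_pi_sum; rewrite memvf.
have pi0E (p q : I) v : v \in gr (val q.1, val q.2) -> pi0 p v = if p == q then v else 0.
  move=> gv; have /directv_sum_unique dn := piece_direct gr n.
  have := dn (pi0^~ v) (fun r => if r == q then v else 0).
  rewrite /= sum_pi0 -big_mkcond /= big_pred1_eq eqxx.
  have h1 (r : I) : true -> pi0 r v \in gr (val r.1, val r.2) by move=> _; exact: memv_sum_pi.
  have h2 (r : I) : true -> (if r == q then v else 0) \in gr (val r.1, val r.2).
    by case: eqP => [->|] // _ _; exact: mem0v.
  by move=> /(_ h1 h2)/esym/forallP/(_ p)/eqP.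
(* The pieces with indices below [n] already fill [V], so by directness over a larger square any
   other piece is zero. *)
have out q v : v \in gr q -> ~~ ((q.1 < n) && (q.2 < n))%N -> v = 0.
  move=> gv q_out; pose M := maxn n (maxn q.1 q.2).+1.
  have le_nM : (n <= M)%N := leq_maxl _ _.
  have q1M : (q.1 < M)%N by rewrite leq_max [X in _ || X]ltnS leq_maxl orbT.
  have q2M : (q.2 < M)%N by rewrite leq_max [X in _ || X]ltnS leq_maxr orbT.
  have /directv_sumP/(_ (Ordinal q1M, Ordinal q2M) isT) /= := piece_direct gr M.
  move=> cap0; apply/eqP; rewrite -memv0 -cap0 memv_cap /= -surjective_pairing gv.
  have: v \in (fullv : {vspace V}) by rewrite memvf.
  rewrite -gr_n; apply/subvP/subv_sumP => -[i j] _.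
  apply: (@sumv_sup _ _ _ (widen_ord le_nM i, widen_ord le_nM j)) => //.
  by apply: contra q_out => /eqP[] <- <- /=; rewrite !ltn_ord.
exists pi => -[p1 p2] /= lt1 lt2.
have -> : pi (p1, p2) = pi0 (Ordinal (leq_trans lt1 le_mn), Ordinal (leq_trans lt2 le_mn)).
  rewrite /pi /=; case: insubP => [i _ ei|]; last by rewrite (leq_trans lt1 le_mn).
  case: insubP => [j _ ej|]; last by rewrite (leq_trans lt2 le_mn).
  by congr (pi0 (_, _)); apply: val_inj.
split=> [v gv|q v gv ne].
  by rewrite (pi0E _ (Ordinal (leq_trans lt1 le_mn), Ordinal (leq_trans lt2 le_mn)) v) ?eqxx.
have [/andP[q1 q2]|/(out q v gv)->] := boolP ((q.1 < n) && (q.2 < n))%N; last by rewrite linear0.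
rewrite (pi0E _ (Ordinal q1, Ordinal q2)) /= -?surjective_pairing //.
by case: eqP => // -[] e1 e2; case/eqP: ne; rewrite e1 e2 -surjective_pairing.
Qed.

(** [e] takes the first vectors of a basis of each piece, [c] the coordinates composed with a
    projection; [vs] bounds the indices of the projections required. *)
Lemma dual_families (h : nat * nat -> nat) (vs : seq (nat * nat)) :
  (forall p, 0 < h p -> p \in vs)%N -> (forall p, h p <= \dim (gr p))%N ->
  exists (e : nat * nat -> nat -> V) (c : nat * nat -> nat -> 'Hom(V, K^o)),
  [/\ forall p k, (k < h p)%N -> e p k \in gr p,
      forall p k l, (k < h p)%N -> (l < h p)%N -> c p k (e p l) = (k == l)%:R
    & forall p q k v, (k < h p)%N -> v \in gr q -> p != q -> c p k v = 0].
Proof.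
move=> h_vs h_le; pose m := (\max_(p <- vs) maxn p.1 p.2).+1.
have lt_m p : (0 < h p)%N -> (p.1 < m)%N /\ (p.2 < m)%N.
  move=> /h_vs p_vs; have le_pm : (maxn p.1 p.2 <= \max_(q <- vs) maxn q.1 q.2)%N.
    by rewrite (big_rem p) //= leq_maxl.
  by rewrite !ltnS; split; apply: leq_trans le_pm; rewrite (leq_maxl, leq_maxr).
have [pi piP] := piece_projections m.
exists (fun p k => (vbasis (gr p))`_k).
exists (fun p k => if insub k is Some i
                   then (linfun (coord (vbasis (gr p)) i : V -> K^o) \o pi p)%VF else 0).
split=> [p k lt_k|p k l lt_k lt_l|p q k v lt_k gv ne].
- by apply: vbasis_mem; rewrite mem_nth // size_tuple (leq_trans lt_k).
- have [lt1 lt2] := lt_m p (leq_ltn_trans (leq0n _) lt_k).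
  have kd := leq_trans lt_k (h_le p); have ld := leq_trans lt_l (h_le p).
  rewrite insubT comp_lfunE lfunE /= (piP p lt1 lt2).1; last first.
    by apply: vbasis_mem; rewrite mem_nth // size_tuple.
  rewrite -[l]/(val (Ordinal ld)) coord_free ?(basis_free (vbasisP _)) //.
  by rewrite eq_sym; congr _%:R.
- have [lt1 lt2] := lt_m p (leq_ltn_trans (leq0n _) lt_k).
  case: insubP => [i _ _|]; last by rewrite zero_lfunE.
  by rewrite comp_lfunE ((piP p lt1 lt2).2 q v gv ne) linear0.
Qed.

(** Each application lowers one coordinate, pieces with a zero coordinate vanish, and finitely many
    pieces span [V]. *)
Lemma nilpotent_of_lowering (b : bool) (f : 'End(V)) :
  (forall p v, v \in gr p -> f v \in gr (lower b p)) -> nilpotent_end f.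
Proof.
move=> f_gr; pose d (p : nat * nat) := if b then p.2 else p.1.
have iter00 n : iter n f 0 = 0 by elim: n => //= n ->; rewrite linear0.
have iter0 n p v : v \in gr p -> (d p <= n)%N -> iter n f v = 0.
  elim: n p v => [|n IHn] p v gv.
    rewrite leqn0 => d0; apply/eqP; rewrite -memv0 /=.
    suff <- : gr p = 0%VS by [].
    case: p d0 {gv} => s t; rewrite /d /=.
    by case: ifP => _ d0; apply: piece_eq0; rewrite d0 ?orbT.
  rewrite iterSr => le_d; apply: (IHn (lower b p)); first exact: f_gr.
  by move: le_d; rewrite /d /lower; case: ifP => _ /=; lia.
have iterD n (v w : V) : iter n f (v + w) = iter n f v + iter n f w.
  by elim: n => //= n ->; rewrite linearD.
have [n _ gr_n] := piece_full_above 0.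
exists n => v.
have /memv_sumP[w gr_w ->] : v \in (\sum_(p : 'I_n * 'I_n) gr (val p.1, val p.2))%VS.
  by rewrite gr_n memvf.
rewrite (big_morph _ (iterD _) (iter00 _)) big1 // => p _.
by apply: iter0 (gr_w p isT) _; rewrite /d; case: ifP => _; exact: ltnW (ltn_ord _).
Qed.
End GradedLinearMaps.

(** * Matrix representations realized as endomorphisms of [V] *)

Section RankOne.
Variables (K : fieldType) (V : vectType K) (f : 'Hom(V, K^o)) (e : V).

Definition rank1_fun (v : V) : V := (f v : K) *: e.

Fact rank1_fun_linear : linear rank1_fun.
Proof. by move=> a u v; rewrite /rank1_fun linearP scalerDl scalerA. Qed.

HB.instance Definition _ :=
  GRing.isLinear.Build K V V *:%R rank1_fun rank1_fun_linear.

Definition rank1 : 'End(V) := linfun rank1_fun.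

Lemma rank1E v : rank1 v = (f v : K) *: e.
Proof. by rewrite lfunE. Qed.

End RankOne.

(* A representation [A] with dimension vector [h] has along the arrow
   [p -> lower b p] the matrix [A b p l k], with row index [l] and column
   index [k]. *)
Definition intertwines (K : fieldType) (h : nat * nat -> nat)
    (A B : bool -> nat * nat -> nat -> nat -> K)
    (x : nat * nat -> nat -> nat -> K) (b : bool) (p : nat * nat) : Prop :=
  forall m k, (m < h (lower b p))%N -> (k < h p)%N ->
  \sum_(l < h p) B b p m l * x p l k
  = \sum_(l < h (lower b p)) A b p l k * x (lower b p) m l.

Definition square_commutes (K : fieldType) (h : nat * nat -> nat)
    (A : bool -> nat * nat -> nat -> nat -> K) (p : nat * nat) : Prop :=
  forall m k, (m < h (lower false (lower true p)))%N -> (k < h p)%N ->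
  \sum_(l < h (lower true p)) A false (lower true p) m l * A true p l k
  = \sum_(l < h (lower false p)) A true (lower false p) m l * A false p l k.

Section Realization.
Variables (K : fieldType) (V : vectType K) (gr : bigrading V).
Variables (h : nat * nat -> nat) (vs : seq (nat * nat)).
Hypotheses (vs_uniq : uniq vs) (h_vs : forall p, (0 < h p)%N -> p \in vs).
Variables (e : nat * nat -> nat -> V) (c : nat * nat -> nat -> 'Hom(V, K^o)).
Hypothesis e_gr : forall p k, (k < h p)%N -> e p k \in gr p.
Hypothesis c_e : forall p k l,
  (k < h p)%N -> (l < h p)%N -> c p k (e p l) = (k == l)%:R.
Hypothesis c_gr : forall p q k v,
  (k < h p)%N -> v \in gr q -> p != q -> c p k v = 0.

Implicit Type A : bool -> nat * nat -> nat -> nat -> K.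

(** The extension by zero: the matrices act on the span of the [e p k], and a vector on which all
    [c p k] vanish is killed. *)
Definition realize A b : 'End(V) :=
  \sum_(p <- vs) \sum_(k < h p) \sum_(l < h (lower b p))
    A b p l k *: rank1 (c p k) (e (lower b p) l).

Lemma realizeE A b p v : v \in gr p ->
  realize A b v = \sum_(l < h (lower b p))
    (\sum_(k < h p) A b p l k * (c p k v : K)) *: e (lower b p) l.
Proof.
move=> gv; rewrite sum_lfunE; pose F q : V := \sum_(l < h (lower b q))
    (\sum_(k < h q) A b q l k * (c q k v : K)) *: e (lower b q) l.
transitivity (\sum_(q <- vs) F q).
  apply: eq_bigr => q _; rewrite /F sum_lfunE.
  under eq_bigr do rewrite sum_lfunE; rewrite exchange_big; apply: eq_bigr => l _.
  rewrite scaler_suml; apply: eq_bigr => k _.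
  by rewrite scale_lfunE rank1E scalerA.
have F0 q : q != p -> F q = 0.
  move=> ne; apply: big1 => l _; rewrite big1 ?scale0r // => k _.
  by rewrite (c_gr _ gv ne) ?mulr0.
have [p_vs|p_vs] := boolP (p \in vs).
  by rewrite (bigD1_seq p) //= big1 ?addr0 // => q /F0.
rewrite big_seq big1 => [|q q_vs]; last by apply: F0; apply: contraNneq p_vs => <-.
rewrite big1 // => l _; rewrite big1 ?scale0r // => k _.
by case/negP: p_vs; apply: h_vs; apply: leq_ltn_trans (ltn_ord k).
Qed.

Lemma realize_lower A b p v : v \in gr p -> realize A b v \in gr (lower b p).
Proof.
by move=> gv; rewrite (realizeE _ _ gv) memv_suml // => l _; rewrite memvZ ?e_gr.
Qed.

Lemma coord_realize A b p v l : v \in gr p -> (l < h (lower b p))%N ->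
  c (lower b p) l (realize A b v) = \sum_(k < h p) A b p l k * (c p k v : K).
Proof.
move=> gv lt_l; rewrite (realizeE _ _ gv) linear_sum (bigD1 (Ordinal lt_l)) //=.
rewrite linearZ /= c_e // eqxx [X in _ + X]big1 ?addr0 => [|i ne].
  by rewrite mulr1n [LHS]mulr1.
rewrite linearZ /= c_e // (_ : (l == i) = false) ?scaler0 //.
by apply: contraNF ne => /eqP l_i; apply/eqP/val_inj.
Qed.

Lemma realize_basis A b p k : (k < h p)%N ->
  realize A b (e p k) = \sum_(l < h (lower b p)) A b p l k *: e (lower b p) l.
Proof.
move=> lt_k; rewrite (realizeE _ _ (e_gr lt_k)); apply: eq_bigr => l _.
rewrite (bigD1 (Ordinal lt_k)) //= c_e // eqxx mulr1 big1 ?addr0 // => i ne.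
rewrite c_e // (_ : (_ == k) = false) ?mulr0 //.
by apply: contraNF ne => /eqP i_k; apply/eqP/val_inj.
Qed.

Lemma realize_graded_nilpotent_pair A : (forall p, square_commutes h A p) ->
  graded_nilpotent_pair gr (realize A false, realize A true).
Proof.
move=> comm_A; split=> /=.
- apply: (@eq_on_pieces _ _ gr) => p v gv; rewrite !comp_lfunE.
  rewrite (realizeE A false (realize_lower A true gv)).
  rewrite (realizeE A true (realize_lower A false gv)).
  (* The two lowered vertices are convertible, so the basis vectors agree and only the coefficients
     remain. *)
  apply: eq_bigr => m _; congr (_ *: _).
  under eq_bigr => l _ do rewrite (coord_realize A gv) // mulr_sumr.
  under [RHS]eq_bigr => l _ do rewrite (coord_realize A gv) // mulr_sumr.
  rewrite exchange_big [RHS]exchange_big; apply: eq_bigr => k _ /=.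
  under eq_bigr => l _ do rewrite mulrA.
  under [RHS]eq_bigr => l _ do rewrite mulrA.
  by rewrite -!mulr_suml comm_A.
- exact: (nilpotent_of_lowering (realize_lower A false)).
- exact: (nilpotent_of_lowering (realize_lower A true)).
- by move=> s t; apply/subvP => _ /memv_imgP[v gv ->]; exact: (realize_lower A false gv).
- by move=> s t; apply/subvP => _ /memv_imgP[v gv ->]; exact: (realize_lower A true gv).
Qed.

(** A conjugating [g] satisfies [B g = g A]. Its compression [x] to the span of the [e p k] still
    intertwines, since [realize A] maps into this span and [realize B] sees only the coordinates
    [c]. If column [k] of [x p] is zero, [realize B] kills [g (e p k)], so [realize A] kills [e p k]
    by injectivity of [g]. *)
Lemma intertwines_of_orbit_eq A B :
  conj_orbit gr (realize A false, realize A true)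
    = conj_orbit gr (realize B false, realize B true) ->
  exists2 x, forall b p, intertwines h A B x b p
    & forall b p k l, (k < h p)%N -> (l < h (lower b p))%N ->
        (forall i, (i < h p)%N -> x p i k = 0) -> A b p l k = 0.
Proof.
move=> eq_orbit.
have : conj_orbit gr (realize B false, realize B true) (realize B false, realize B true).
  exists \1%VF.
    by split=> [|p]; [apply/eqP/lker0P => u v; rewrite !id_lfunE | rewrite lim1g].
  have inv1 : (\1^-1)%VF = \1%VF :> 'End(V).
    have k1 : lker (\1 : 'End(V))%VF == 0%VS by apply/lker0P => u v; rewrite !id_lfunE.
    by rewrite -[LHS]comp_lfun1r lker0_compVf.
  by rewrite inv1 !comp_lfun1r !comp_lfun1l.
rewrite -eq_orbit => -[g [ker_g gr_g] [gE0 gE1]].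
have ker0 : lker g == 0%VS by apply/eqP.
have gE b v : realize B b (g v) = g (realize A b v).
  have -> : realize B b = (g \o realize A b \o g^-1)%VF by case: b; rewrite ?gE0 ?gE1.
  by rewrite !comp_lfunE lker0_lfunK.
have g_gr p v : v \in gr p -> g v \in gr p by move=> gv; rewrite -gr_g memv_img.
exists (fun p l k => c p l (g (e p k))) => [b p m k lt_m lt_k|b p k l lt_k lt_l x0].
  have <- := coord_realize B (g_gr _ _ (e_gr lt_k)) lt_m.
  rewrite gE realize_basis // !linear_sum; apply: eq_bigr => l _.
  by rewrite !linearZ.
have: g (realize A b (e p k)) = 0.
  rewrite -gE (realizeE B b (g_gr _ _ (e_gr lt_k))) big1 // => i _.
  by rewrite big1 ?scale0r // => j _; rewrite x0 ?mulr0.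
rewrite -[RHS](linear0 g) => /(lker0P ker0) Ae0.
have := coord_realize A (e_gr lt_k) lt_l; rewrite Ae0 linear0.
rewrite (bigD1 (Ordinal lt_k)) //= c_e // eqxx mulr1 big1 ?addr0 // => i ne.
rewrite c_e // (_ : (_ == k) = false) ?mulr0 //.
by apply: contraNF ne => /eqP i_k; apply/eqP/val_inj.
Qed.

End Realization.

(** * Elimination with integral linear forms, valid over every field *)

Section LinearForms.
Variable T : eqType.
Definition form := seq (T * int).

Fixpoint add_term (v : T) (a : int) (f : form) : form :=
  if f is u :: f' then
    if u.1 == v then (if u.2 + a == 0 then f' else (v, u.2 + a) :: f')
    else u :: add_term v a f'
  else [:: (v, a)].

Definition add_multiple (a : int) (g f : form) : form :=
  foldr (fun u => add_term u.1 (a * u.2)) f g.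

Definition coefficient (v : T) (f : form) : int :=
  foldr (fun u a => if u.1 == v then u.2 + a else a) 0 f.

(* A triple [(v, s, f)] stands for an equation [f = 0] used to eliminate the
   variable [v], whose coefficient in [f] is the sign [s]. *)
Definition eliminate (f : form) (piv : T * int * form) : form :=
  let a := coefficient piv.1.1 f in
  if a == 0 then f else add_multiple (- (a * piv.1.2)) piv.2 f.

(* Only coefficients [1] and [-1] serve as pivots, so that the elimination is
   valid over every field. *)
Fixpoint echelon (pivs : seq (T * int * form)) (eqs : seq form) :=
  if eqs is f :: eqs' then
    let f' := foldl eliminate f pivs in
    if [seq u <- f' | u.2 \in [:: 1; -1]] is u :: _
    then echelon (rcons pivs (u, f')) eqs' else echelon pivs eqs'
  else pivs.

(** A sound test that may miss consequences: equations left without a coefficient [1] or [-1] are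
    dropped. *)
Definition entails (eqs : seq form) (f : form) : bool :=
  nilp (foldl eliminate f (echelon [::] eqs)).

Variables (K : fieldType) (x : T -> K).

Definition feval (f : form) : K := \sum_(u <- f) u.2%:~R * x u.1.

Lemma feval_add_term v a f : feval (add_term v a f) = a%:~R * x v + feval f.
Proof.
elim: f => [|u f IHf] /=; first by rewrite /feval !big_cons big_nil.
case: eqP => [<-|_]; last by rewrite /feval !big_cons -/(feval _) IHf addrCA.
case: eqP => [/eqP|_]; last by rewrite /feval !big_cons /= rmorphD /= mulrDl addrCA addrA.
by rewrite addr_eq0 => /eqP uE; rewrite /feval big_cons uE rmorphN /= mulNr addNKr.
Qed.

Lemma feval_add_multiple a g f :
  feval (add_multiple a g f) = a%:~R * feval g + feval f.
Proof.
elim: g => [|u g IHg] /=; first by rewrite /feval big_nil mulr0 add0r.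
by rewrite feval_add_term IHg /feval big_cons -/(feval g) -/(feval f) rmorphM /=; ring.
Qed.

Lemma feval_foldl_eliminate pivs f :
  {in pivs, forall p, feval p.2 = 0} -> feval (foldl eliminate f pivs) = feval f.
Proof.
elim: pivs f => //= p pivs IHpivs f p0; rewrite IHpivs => [|q q_in]; last first.
  by apply: p0; rewrite inE q_in orbT.
rewrite /eliminate; case: ifP => // _.
by rewrite feval_add_multiple p0 ?mem_head // mulr0 add0r.
Qed.

Lemma feval_echelon pivs eqs :
    {in pivs, forall p, feval p.2 = 0} -> {in eqs, forall f, feval f = 0} ->
  {in echelon pivs eqs, forall p, feval p.2 = 0}.
Proof.
elim: eqs pivs => //= f eqs IHeqs pivs pivs0 eqs0.
have eqs0' : {in eqs, forall g, feval g = 0}.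
  by move=> g g_in; apply: eqs0; rewrite inE g_in orbT.
case: [seq _ <- _ | _] => [|u _]; first exact: IHeqs.
apply: IHeqs => // p; rewrite mem_rcons inE => /predU1P[->|/pivs0//] /=.
by rewrite feval_foldl_eliminate // eqs0 ?mem_head.
Qed.

Lemma feval_entails eqs f :
  {in eqs, forall g, feval g = 0} -> entails eqs f -> feval f = 0.
Proof.
move=> eqs0 /nilP f0; rewrite -(@feval_foldl_eliminate (echelon [::] eqs)) ?f0.
  by rewrite /feval big_nil.
exact: feval_echelon.
Qed.

End LinearForms.

(** * Representations with a distinguished arrow, and their pencils *)

(* An integral representation of the staircase quiver, together with one
   distinguished arrow, from [tip] to [lower tip_dir tip]. *)
Record tipped_rep := TippedRep {
  dimv : nat * nat -> nat;
  verts : seq (nat * nat);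
  matv : bool -> nat * nat -> nat -> nat -> int;
  tip_dir : bool;
  tip : nat * nat }.

Section TippedRep.
Variable R : tipped_rep.
Local Notation h := (dimv R).
Local Notation base := (lower (tip_dir R) (tip R)).

(** One entry of the intertwining condition as a linear form, where [(p, (l, k))] names the unknown
    [x p l k]. *)
Definition arrow_form (b : bool) (p : nat * nat) (m k : nat) :
    form ((nat * nat) * (nat * nat))%type :=
  [seq u <- [seq ((p, (l, k)), matv R b p m l) | l <- iota 0 (h p)]
         ++ [seq ((lower b p, (m, l)), - matv R b p l k) | l <- iota 0 (h (lower b p))]
     | u.2 != 0].

Definition arrow_forms : seq (form ((nat * nat) * (nat * nat))%type) :=
  [seq arrow_form bp.1 bp.2 mk.1 mk.2
    | bp <- [seq bp <- allpairs pair [:: false; true] (verts R) | bp != (tip_dir R, tip R)],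
      mk <- allpairs pair (iota 0 (h (lower bp.1 bp.2))) (iota 0 (h bp.2))].

(** The sums are written with [foldr] because the locked big operators do not evaluate. *)
Definition square_commutes_int (p : nat * nat) : bool :=
  all (fun mk =>
    foldr (fun l => +%R (matv R false (lower true p) mk.1 l * matv R true p l mk.2)) 0
      (iota 0 (h (lower true p)))
    == foldr (fun l => +%R (matv R true (lower false p) mk.1 l * matv R false p l mk.2)) 0
      (iota 0 (h (lower false p))))
  (allpairs pair (iota 0 (h (lower false (lower true p)))) (iota 0 (h p))).

(** The last two conditions keep [t] out of every square: no vertex has an arrow into [tip], and the
    other arrow leaving [base] kills the second basis vector, the one that [t] multiplies. *)
Definition tip_ok : bool :=
  [&& h (tip R) == 1%N, h base == 2%N,
      matv R (tip_dir R) (tip R) 0%N 0%N == 1, matv R (tip_dir R) (tip R) 1%N 0%N == 0,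
      all (fun p => (lower false p != tip R) && (lower true p != tip R)) (verts R)
    & all (fun m => matv R (~~ tip_dir R) base m 1%N == 0)
        (iota 0 (h (lower (~~ tip_dir R) base)))].

(* Every endomorphism of the representation obtained by dropping the
   distinguished arrow acts as a scalar on the plane at [base]. *)
Definition scalar_at_base : bool :=
  all (entails arrow_forms)
    [:: [:: ((base, (0, 1)%N), 1)]; [:: ((base, (1, 0)%N), 1)];
        [:: ((base, (0, 0)%N), 1); ((base, (1, 1)%N), -1)]].

Definition tipped_rep_ok : bool :=
  [&& uniq (verts R), all square_commutes_int (verts R), tip_ok & scalar_at_base].

(* The map along the distinguished arrow embeds the line at [tip] as the span
   of [(1, t)]. *)
Definition pencil (K : fieldType) (t : K) (b : bool) (p : nat * nat) (l k : nat) : K :=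
  (matv R b p l k)%:~R
  + (if [&& b == tip_dir R, p == tip R, l == 1%N & k == 0%N] then t else 0).

End TippedRep.

Lemma big_iota_ord (Z : nmodType) n (F : nat -> Z) :
  \sum_(l <- iota 0 n) F l = \sum_(l < n) F l.
Proof. by rewrite -(big_mkord xpredT) /index_iota subn0. Qed.

Lemma foldr_iota_ord n (F : nat -> int) :
  foldr (fun l => +%R (F l)) 0 (iota 0 n) = \sum_(l < n) F l.
Proof. by rewrite -big_iota_ord unlock. Qed.

Section Pencil.
Variables (R : tipped_rep) (K : fieldType).
Hypothesis R_ok : tipped_rep_ok R.
Hypothesis h_verts : forall p, (0 < dimv R p)%N -> p \in verts R.
Local Notation h := (dimv R).
Local Notation base := (lower (tip_dir R) (tip R)).

Lemma pencil_square_commutes (t : K) p : square_commutes h (pencil R t) p.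
Proof.
move=> m k lt_m lt_k; have p_vs := h_verts (leq_ltn_trans (leq0n _) lt_k).
have /and4P[_ /allP/(_ _ p_vs)/allP sq tipR _] := R_ok.
have /and5P[_ _ _ _ /andP[/allP/(_ _ p_vs)/andP[tip0 tip1] /allP side0]] := tipR.
have ne b : lower b p != tip R by case: b.
have lt_mb b : (m < h (lower (~~ b) (lower b p)))%N by case: b.
(* Along a path of length two, every term with [t] has a zero factor. *)
have key b : \sum_(l < h (lower b p)) pencil R t (~~ b) (lower b p) m l * pencil R t b p l k
   = (\sum_(l < h (lower b p)) matv R (~~ b) (lower b p) m l * matv R b p l k)%:~R.
  rewrite rmorph_sum; apply: eq_bigr => l _; rewrite /pencil rmorphM /=.
  rewrite (negPf (ne b)) andbF addr0.
  case: ifP => [/and4P[/eqP bE /eqP pE /eqP lE _]|]; last by rewrite addr0.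
  rewrite (_ : matv R (~~ b) (lower b p) m l = 0) ?mul0r //.
  by rewrite lE pE bE; apply/eqP/side0; rewrite mem_iota add0n -bE -pE lt_mb.
rewrite (key true) (key false); congr _%:~R.
have /sq : (m, k) \in allpairs pair (iota 0 (h (lower false (lower true p)))) (iota 0 (h p)).
  by apply/allpairsP; exists (m, k); rewrite !mem_iota !add0n lt_m lt_k.
by rewrite /= !foldr_iota_ord => /eqP.
Qed.

Lemma pencil_intertwines (t s : K) x :
    (forall b p, intertwines h (pencil R t) (pencil R s) x b p) ->
  x (tip R) 0%N 0%N = 0 \/ t = s.
Proof.
move=> xM.
have /and4P[_ _ /and5P[/eqP h_tip /eqP h_base /eqP tip00 /eqP tip10 _] /allP scalar] := R_ok.
pose y u := x u.1 u.2.1 u.2.2.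
have forms0 : {in arrow_forms R, forall f, feval y f = 0}.
  move=> _ /allpairsPdep[[b p] [[m k] [/= bp mk ->]]].
  move: bp mk; rewrite mem_filter => /andP[ne _] /allpairsP[[m' k'] /= []].
  rewrite !mem_iota !add0n => lt_m lt_k [-> ->] {m k}.
  have pencilE (r : K) m k : pencil R r b p m k = (matv R b p m k)%:~R.
    by rewrite /pencil; case: ifP ne => [/and4P[/eqP-> /eqP-> _ _]|_ _]; rewrite ?eqxx ?addr0.
  have := xM b p m' k' lt_m lt_k.
  under eq_bigr do rewrite pencilE; under [RHS]eq_bigr do rewrite pencilE.
  move=> /eqP; rewrite -subr_eq0 => /eqP <-.
  rewrite /feval big_filter big_mkcond /= big_cat !big_map /= -sumrN !big_iota_ord.
  congr (_ + _); apply: eq_bigr => l _ /=.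
    by case: eqP => [->|]; rewrite ?mul0r.
  by rewrite oppr_eq0 rmorphN /= mulNr; case: eqP => [->|]; rewrite ?mul0r ?oppr0.
have x01 : x base 0%N 1%N = 0.
  have := feval_entails forms0 (scalar [:: ((base, (0, 1)%N), 1)] _).
  by rewrite /feval big_seq1 mul1r; apply; rewrite !inE eqxx ?orbT.
have x10 : x base 1%N 0%N = 0.
  have := feval_entails forms0 (scalar [:: ((base, (1, 0)%N), 1)] _).
  by rewrite /feval big_seq1 mul1r; apply; rewrite !inE eqxx ?orbT.
have x00 : x base 0%N 0%N = x base 1%N 1%N.
  have := feval_entails forms0 (scalar [:: ((base, (0, 0)%N), 1); ((base, (1, 1)%N), -1)] _).
  rewrite /feval big_cons big_seq1 mul1r mulN1r => /(_ _)/subr0_eq.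
  by apply; rewrite !inE eqxx ?orbT.
(* As [x] is a scalar [a] at [base], the rows of the distinguished arrow read [x_tip = a] and
   [s * x_tip = t * a]. *)
have := xM (tip_dir R) (tip R) 0%N 0%N; rewrite h_tip h_base => /(_ isT isT).
have := xM (tip_dir R) (tip R) 1%N 0%N; rewrite h_tip h_base => /(_ isT isT).
rewrite !big_ord_recl !big_ord0 /= /pencil !eqxx /= tip00 tip10.
rewrite !(mulr0, mul1r, mul0r, addr0, add0r) x01 x10 -x00 !(mulr0, addr0, add0r).
move=> e1 e0; have /eqP : (s - t) * x (tip R) 0%N 0%N = 0 by rewrite mulrBl e1 e0 subrr.
by rewrite mulf_eq0 subr_eq0 => /orP[/eqP->|/eqP]; [right | left].
Qed.
End Pencil.

(** * Lagrange reduction of integral quadratic forms *)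

Fixpoint dot (r x : seq int) : int :=
  if (r, x) is (c :: r', y :: x') then c * y + dot r' x' else 0.

(* A quadratic form in variables [x_0, x_1, ...]: the entry [(a, r)] at position
   [i] stands for [a * x_i ^ 2 + x_i * \sum_j r_j * x_(i + 1 + j)]. *)
Definition quadratic := seq (int * seq int).

Fixpoint qeval (q : quadratic) (x : seq int) : int :=
  if (q, x) is ((a, r) :: q', y :: x') then
    a * y ^+ 2 + y * dot r x' + qeval q' x'
  else 0.

Fixpoint wf_quadratic (q : quadratic) : bool :=
  if q is (_, r) :: q' then (size r == size q') && wf_quadratic q' else true.

(** The form [4 * a * q - (r . x) ^ 2], which remains when [(2 * a * y + r . x) ^ 2] is split off
    from [4 * a] times the form with head [(a, r)] and tail [q]; this avoids denominators. *)
Fixpoint complete_square (a : int) (r : seq int) (q : quadratic) : quadratic :=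
  if (q, r) is ((b, u) :: q', c :: r') then
    (4 * a * b - c ^+ 2,
     [seq 4 * a * v.1 - 2 * c * v.2 | v <- zip u r']) :: complete_square a r' q'
  else [::].

(** Dividing by the content keeps the coefficients small; the final test certifies that the division
    is exact. *)
Definition primitive_part (q : quadratic) : quadratic :=
  let g := foldr (fun u g => gcdz u.1 (foldr gcdz g u.2)) 0 q in
  let q' := [seq ((u.1 %/ g)%Z, [seq (v %/ g)%Z | v <- u.2]) | u <- q] in
  if (0 < g) && ([seq (g * u.1, [seq g * v | v <- u.2]) | u <- q'] == q)
  then q' else q.

(* Lagrange reduction: linear forms whose common zeros are the zeros of [q], or
   [None] if [q] is not positive semidefinite. *)
Fixpoint lagrange (n : nat) (q : quadratic) : option (seq (seq int)) :=
  if q is (a, r) :: q' then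
    if n is n'.+1 then
      if 0 < a then
        omap (fun R => (2 * a :: r) :: map (cons 0) R)
          (lagrange n' (primitive_part (complete_square a r q')))
      else if (a == 0) && all (eq_op 0) r then
        omap (map (cons 0)) (lagrange n' q')
      else None
    else None
  else Some [::].

Lemma dot_scale g r x : dot [seq g * v | v <- r] x = g * dot r x.
Proof. by elim: r x => [|c r IHr] [|y x] /=; rewrite ?IHr; ring. Qed.

Lemma dot0 r x : all (eq_op 0) r -> dot r x = 0.
Proof.
by elim: r x => [|c r IHr] [|y x] //= /andP[/eqP <- /IHr->]; rewrite mul0r addr0.
Qed.

Lemma qeval_scale g q x :
  qeval [seq (g * u.1, [seq g * v | v <- u.2]) | u <- q] x = g * qeval q x.
Proof.
elim: q x => [|[a r] q IHq] [|y x] /=; rewrite ?mulr0 //.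
by rewrite IHq dot_scale; ring.
Qed.

Lemma wf_quadratic_map g q :
  wf_quadratic [seq (g u.1, [seq g v | v <- u.2]) | u <- q] = wf_quadratic q.
Proof. by elim: q => [|[a r] q IHq] //=; rewrite IHq !size_map. Qed.

Lemma primitive_partP q : exists2 g, 0 < g &
  [/\ forall x, qeval q x = g * qeval (primitive_part q) x,
      size (primitive_part q) = size q
    & wf_quadratic (primitive_part q) = wf_quadratic q].
Proof.
rewrite /primitive_part; set g := foldr _ _ _; set q' := [seq _ | u <- q].
have [/andP[g_gt0 /eqP qE]|_] := boolP ((0 < g) && _); last first.
  by exists 1; split=> // x; rewrite mul1r.
exists g => //; split=> [x||]; last 2 first.
- by rewrite size_map.
- exact: (wf_quadratic_map (fun v => (v %/ g)%Z)).
by rewrite -{1}qE qeval_scale.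
Qed.

Lemma dot_complete a c u r x : size u = size r ->
  dot [seq 4 * a * v.1 - 2 * c * v.2 | v <- zip u r] x
  = 4 * a * dot u x - 2 * c * dot r x.
Proof.
elim: u r x => [|v u IHu] [|w r] [|y x] //=; try by move=> _; ring.
by move=> [/IHu->]; ring.
Qed.

Lemma complete_squareP a r q x :
    wf_quadratic q -> size r = size q -> size x = size q ->
  [/\ qeval (complete_square a r q) x = 4 * a * qeval q x - dot r x ^+ 2,
      size (complete_square a r q) = size q & wf_quadratic (complete_square a r q)].
Proof.
elim: q r x => [|[b u] q IHq] [|c r] [|y x] //=.
  by move=> _ _ _; split=> //; ring.
move=> /andP[/eqP size_u wf_q] [size_r] [size_x].
have [-> -> ->] := IHq r x wf_q size_r size_x.
rewrite dot_complete ?size_u // size_map size_zip size_u size_r minnn eqxx.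
by split=> //; ring.
Qed.

Lemma lagrangeP n q R x :
    wf_quadratic q -> size x = size q -> lagrange n q = Some R ->
  0 <= qeval q x /\ (qeval q x = 0 -> all (fun r => dot r x == 0) R).
Proof.
elim: n q R x => [|n IHn] [|[a r] q] R [|y x] //=; try by move=> _ _ [<-].
move=> /andP[/eqP size_r wf_q] [size_x].
have all_cons S : all (fun s => dot s (y :: x) == 0) (map (cons 0) S)
                = all (fun s => dot s x == 0) S.
  by rewrite all_map; apply: eq_all => s /=; rewrite mul0r add0r.
case: ifP => [a_gt0|_]; last first.
  case: ifP => // /andP[/eqP -> r0]; rewrite (dot0 _ r0) mul0r mulr0 !add0r.
  case lag: lagrange => [S|] //= [<-].
  by have [q_ge0 q0] := IHn _ _ _ wf_q size_x lag; rewrite all_cons.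
have [sqE size_sq wf_sq] := complete_squareP a wf_q size_r size_x.
have [g g_gt0 [ppE size_pp wf_pp]] := primitive_partP (complete_square a r q).
case lag: lagrange => [S|] //= [<-] /=; rewrite all_cons.
have [||q_ge0 q0] := IHn _ S x _ _ lag.
- by rewrite wf_pp.
- by rewrite size_pp size_sq.
set Q := (X in 0 <= X).
have a4_gt0 : 0 < 4 * a by rewrite mulr_gt0.
(* Both summands are nonnegative, so at a zero of [Q] the linear form and the reduced form
   vanish. *)
have QE : 4 * a * Q = (2 * a * y + dot r x) ^+ 2
    + g * qeval (primitive_part (complete_square a r q)) x.
  by rewrite -ppE sqE /Q; ring.
have gq_ge0 := mulr_ge0 (ltW g_gt0) q_ge0.
split=> [|Q0]; first by rewrite -(pmulr_rge0 _ a4_gt0) QE addr_ge0 // sqr_ge0.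
move/eqP: QE; rewrite (Q0 : Q = 0) mulr0 eq_sym paddr_eq0 ?sqr_ge0 // sqrf_eq0 mulf_eq0.
by rewrite (gt_eqF g_gt0) /= => /andP[-> /eqP/q0].
Qed.

(** * The Tits form in these coordinates *)

(** [boxes] is in lexicographic order, so the three neighbours of [p] named here come after [p] and
    each product is counted once. *)
Definition tits_coef (p q : nat * nat) : int :=
  if q \in [:: (p.1, p.2.+1); (p.1.+1, p.2)] then -1
  else if q == (p.1.+1, p.2.+1) then 1 else 0.

Fixpoint tits_quadratic (s : seq (nat * nat)) : quadratic :=
  if s is p :: s' then (1, [seq tits_coef p q | q <- s']) :: tits_quadratic s'
  else [::].

Lemma wf_tits_quadratic s : wf_quadratic (tits_quadratic s).
Proof.
elim: s => //= p s ->; rewrite size_map andbT.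
by elim: s => //= q s /eqP->.
Qed.

Lemma tits_form_quadratic mu x : mu \in tame_partitions ->
  tits_form mu x = qeval (tits_quadratic (boxes mu)) (map x (boxes mu)).
Proof.
rewrite !inE; do !case/predU1P=> [->|]; last move/eqP->.
all: rewrite /tits_form unlock /= /tits_coef /=; ring.
Qed.

(** * Seven representations given by tables *)

Definition entry (T : Type) (a : T) (tab : seq (seq T)) (p : nat * nat) : T :=
  nth a (a :: nth [::] ([::] :: tab) p.1) p.2.

Definition table_support (dims : seq (seq nat)) : seq (nat * nat) :=
  [seq p <- [seq (i, j) | i <- iota 1 (size dims), j <- iota 1 (size (nth [::] dims i.-1))]
    | 0 < entry 0 dims p]%N.

(* At position [(i, j)], a table holds the dimension of the space at [(i, j)],
   resp. the images of its basis vectors under the arrow in the direction of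
   [(i - 1, j)] (table [phi]) and [(i, j - 1)] (table [psi]), where a list of
   indices stands for the sum of the basis vectors with these indices. *)
Definition table_rep (flip : bool) (dims : seq (seq nat))
    (phi psi : seq (seq (seq (seq nat)))) (tip : nat * nat) : tipped_rep :=
  let sw p : nat * nat := if flip then (p.2, p.1) else p in
  {| dimv p := entry 0%N dims (sw p);
     verts := map sw (table_support dims);
     matv b p l k := (l \in nth [::] (entry [::] (if b (+) flip then psi else phi) (sw p)) k)%:Z;
     tip_dir := ~~ flip;
     tip := sw tip |}.

Lemma table_rep_verts flip dims phi psi tip p :
  (0 < dimv (table_rep flip dims phi psi tip) p ->
   p \in verts (table_rep flip dims phi psi tip))%N.
Proof.
rewrite /=; set sw := fun q : nat * nat => if flip then (q.2, q.1) else q.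
have swK : cancel sw sw by rewrite /sw => -[i j]; case: (flip).
rewrite -/(sw p).
rewrite -{2}[p]swK mem_map; last exact: can_inj swK.
move: (sw p) => {p} [i j] h_gt0; rewrite mem_filter h_gt0.
case: i j h_gt0 => [|i] [|j]; rewrite /entry //= ?nth_nil // => h_gt0.
have lt_i : (i < size dims)%N.
  by rewrite ltnNge; apply: contraL h_gt0 => le_i; rewrite (nth_default _ le_i) nth_nil.
have lt_j : (j < size (nth [::] dims i))%N.
  by rewrite ltnNge; apply: contraL h_gt0 => le_j; rewrite (nth_default _ le_j).
by apply/allpairsPdep; exists i.+1, j.+1; split; rewrite // mem_iota add1n ltnS.
Qed.

Definition rep_3_6 (flip : bool) : tipped_rep := table_rep flip
  [:: [:: 1; 3; 4; 3; 2; 1]; [:: 2; 3; 2]]%N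
  [:: [::];
      [:: [:: [::]; [:: 0]]; [:: [:: 2]; [:: 1]; [:: 0]]; [:: [:: 1]; [:: 0]]]]%N
  [:: [:: [::]; [:: [::]; [:: 0]; [::]]; [:: [:: 2]; [:: 1]; [:: 0]; [:: 1]];
          [:: [:: 2]; [:: 3]; [:: 0; 1]]; [:: [:: 1]; [:: 0]]; [:: [:: 0]]];
      [:: [::]; [:: [:: 0]; [:: 1]; [:: 0]]; [:: [:: 1]; [:: 0]]]]%N
  (1, 6)%N.

Definition rep_1_2_6 (flip : bool) : tipped_rep := table_rep flip
  [:: [:: 3; 5; 4; 3; 2; 1]; [:: 4; 3]; [:: 2]]%N
  [:: [::];
      [:: [:: [:: 0]; [:: 1]; [:: 2]; [::]]; [:: [:: 1; 2]; [:: 3]; [:: 0; 4]]];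
      [:: [:: [:: 1; 3]; [:: 0]]]]%N
  [:: [:: [::]; [:: [:: 1]; [::]; [:: 0]; [:: 2]; [::]];
          [:: [:: 2; 3]; [:: 3]; [:: 4]; [:: 0]]; [:: [:: 3]; [:: 1]; [:: 0]];
          [:: [:: 0; 1]; [:: 2]]; [:: [:: 0]]];
      [:: [::]; [:: [:: 0]; [:: 2]; [:: 1]]]]%N
  (1, 6)%N.

Definition rep_1_3_4 (flip : bool) : tipped_rep := table_rep flip
  [:: [:: 1; 2; 2; 1]; [:: 2; 2; 1]; [:: 1]]%N
  [:: [::];
      [:: [:: [:: 0]; [::]]; [:: [:: 1]; [:: 0]]; [:: [:: 1]]];
      [:: [:: [:: 0]]]]%N
  [:: [:: [::]; [:: [::]; [:: 0]]; [:: [:: 0]; [:: 1]]; [:: [:: 0]]];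
      [:: [::]; [:: [:: 0; 1]; [:: 1]]; [:: [:: 0]]]]%N
  (1, 4)%N.

Definition rep_2_2_5 (flip : bool) : tipped_rep := table_rep flip
  [:: [:: 2; 4; 3; 2; 1]; [:: 3; 3]; [:: 2; 1]]%N
  [:: [::];
      [:: [:: [::]; [:: 1]; [:: 0]]; [:: [:: 3]; [:: 2]; [:: 0; 1; 3]]];
      [:: [:: [:: 2]; [:: 1]]; [:: [:: 2]]]]%N
  [:: [:: [::]; [:: [:: 1]; [::]; [:: 0]; [::]]; [:: [:: 0]; [:: 1; 2]; [:: 2]];
          [:: [:: 1]; [:: 0]]; [:: [:: 0]]];
      [:: [::]; [:: [:: 0]; [:: 2]; [:: 1]]];
      [:: [::]; [:: [:: 1]]]]%N
  (1, 5)%N.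

Definition rep_1_1_2_4 (flip : bool) : tipped_rep := table_rep flip
  [:: [:: 2; 3; 2; 1]; [:: 3; 2]; [:: 2]; [:: 1]]%N
  [:: [::];
      [:: [:: [::]; [:: 0]; [:: 1]]; [:: [:: 1]; [:: 2]]];
      [:: [:: [:: 1]; [:: 0; 2]]];
      [:: [:: [:: 1]]]]%N
  [:: [:: [::]; [:: [:: 1]; [:: 1]; [:: 0]]; [:: [:: 0]; [:: 1; 2]]; [:: [:: 0]]];
      [:: [::]; [:: [:: 2]; [:: 1]]]]%N
  (1, 4)%N.

Definition rep_4_5 (flip : bool) : tipped_rep := table_rep flip
  [:: [:: 0; 1; 2; 2; 1]; [:: 1; 2; 2; 1]]%N
  [:: [::];
      [:: [::]; [:: [::]; [:: 0]]; [:: [:: 1]; [:: 0]]; [:: [:: 0]]]]%N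
  [:: [:: [::]; [::]; [:: [:: 0]; [::]]; [:: [:: 0]; [:: 1]]; [:: [:: 0]]];
      [:: [::]; [:: [:: 0]; [:: 0]]; [:: [:: 0]; [:: 1]]; [:: [:: 1]]]]%N
  (1, 5)%N.

Definition rep_2_3_3 (flip : bool) : tipped_rep := table_rep flip
  [:: [:: 0; 1; 1]; [:: 1; 2; 1]; [:: 1; 1]]%N
  [:: [::];
      [:: [::]; [:: [:: 0]; [::]]; [:: [:: 0]]];
      [:: [:: [:: 0]]; [:: [:: 0; 1]]]]%N
  [:: [:: [::]; [::]; [:: [:: 0]]];
      [:: [::]; [:: [::]; [:: 0]]; [:: [:: 0]]];
      [:: [::]; [:: [:: 0]]]]%N
  (2, 3)%N.

(** * Pencils below the positive nullroots *)

Lemma nullroot_lagrange mu x R : mu \in tame_partitions -> tits_form mu x = 0 ->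
  lagrange (size (boxes mu)) (tits_quadratic (boxes mu)) = Some R ->
  all (fun r => dot r (map x (boxes mu)) == 0) R.
Proof.
move=> mu_tame q0 lag.
have size_tq : size (map x (boxes mu)) = size (tits_quadratic (boxes mu)).
  by rewrite size_map; elim: (boxes mu) => //= p s ->.
have [_] := lagrangeP (wf_tits_quadratic _) size_tq lag.
by rewrite -tits_form_quadratic //; apply.
Qed.

(** Membership in [boxes mu] is included because the pieces of [V] are compared with the nullroot
    only there. *)
Definition dimv_le (R : tipped_rep) (mu : seq nat) (x : nat * nat -> int) : bool :=
  all (fun p => (p \in boxes mu) && ((dimv R p)%:Z <= x p)) (verts R).

Definition pencil_below (mu : seq nat) (x : nat * nat -> int) : Prop :=
  exists R, [/\ tipped_rep_ok R, forall p, (0 < dimv R p)%N -> p \in verts R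
    & dimv_le R mu x].

(** Once the form is reduced to [S], the comparison with [x] is linear integer arithmetic, which
    [lia] decides. *)
Lemma pencil_below_of_lagrange (R : tipped_rep) S mu x :
  tipped_rep_ok R -> (forall p, (0 < dimv R p)%N -> p \in verts R) ->
  lagrange (size (boxes mu)) (tits_quadratic (boxes mu)) = Some S ->
  (all (fun p => 0 <= x p) (boxes mu) -> has (fun p => x p != 0) (boxes mu) ->
   all (fun r => dot r (map x (boxes mu)) == 0) S -> dimv_le R mu x) ->
  mu \in tame_partitions -> positive_nullroot mu x -> pencil_below mu x.
Proof.
move=> R_ok R_verts lag le_R mu_tame [/allP x_ge0 /hasP x_neq0 q0]; exists R; split=> //.
exact: le_R (nullroot_lagrange mu_tame q0 lag).
Qed.

Ltac pencil_below r flip :=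
  match goal with |- _ -> positive_nullroot ?mu _ -> _ =>
    let lag := eval vm_compute in (lagrange (size (boxes mu)) (tits_quadratic (boxes mu))) in
    match lag with Some ?S => apply: (@pencil_below_of_lagrange (r flip) S) end
  end;
  [by vm_compute | by move=> p; exact: table_rep_verts | by vm_compute
  | by rewrite /dimv_le /= /entry /=; lia].

Lemma pencil_below_nullroot mu x :
  mu \in tame_partitions -> positive_nullroot mu x -> pencil_below mu x.
Proof.
move=> mu_tame; move: (mu_tame); rewrite !inE; move: mu_tame => /[swap].
(* The flag [true] transposes; [(5, 5)] and [(3, 3, 3)], for example, reuse a table of a smaller
   diagram, extended by zero. *)
case/predU1P=> [->|]; first by pencil_below rep_3_6 false.
case/predU1P=> [->|]; first by pencil_below rep_1_2_6 false.
case/predU1P=> [->|]; first by pencil_below rep_1_3_4 false.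
case/predU1P=> [->|]; first by pencil_below rep_2_2_5 false.
case/predU1P=> [->|]; first by pencil_below rep_1_1_2_4 false.
case/predU1P=> [->|]; first by pencil_below rep_1_3_4 true.
case/predU1P=> [->|]; first by pencil_below rep_2_2_5 true.
case/predU1P=> [->|]; first by pencil_below rep_3_6 true.
case/predU1P=> [->|]; first by pencil_below rep_1_2_6 true.
case/predU1P=> [->|]; first by pencil_below rep_4_5 false.
case/predU1P=> [->|]; first by pencil_below rep_4_5 false.
case/predU1P=> [->|]; first by pencil_below rep_1_3_4 false.
case/predU1P=> [->|]; first by pencil_below rep_2_3_3 false.
case/predU1P=> [->|]; first by pencil_below rep_2_3_3 false.
case/predU1P=> [->|]; first by pencil_below rep_1_3_4 true.
case/predU1P=> [->|]; first by pencil_below rep_4_5 true.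
by move/eqP=> ->; pencil_below rep_4_5 true.
Qed.

(** * Infinitely many orbits over an algebraically closed field *)

(** If [s] enumerated [K], the product of all [X - a] plus one would be non-constant without a
    root. *)
Lemma closed_field_infinite (K : closedFieldType) : infinite_set [set: K].
Proof.
move=> /finite_seqP[s sE].
pose p : {poly K} := \prod_(a <- s) ('X - a%:P) + 1.
have s_gt0 : (0 < size s)%N.
  have : [set: K]%classic 0 by [].
  by rewrite sE /=; case: (s).
have size_p : size p != 1%N.
  by rewrite /p size_polyDl size_prod_XsubC ?size_poly1 // eqSS -lt0n.
have /closed_rootP[x] := size_p; rewrite /root /p hornerD hornerC => /eqP px.
have : [set: K]%classic x by [].
rewrite sE /= => x_s.
have : root (\prod_(a <- s) ('X - a%:P)) x by rewrite root_prod_XsubC.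
by move=> /eqP p0; move/eqP: px; rewrite p0 add0r oner_eq0.
Qed.

Theorem lemma6p3 (K : closedFieldType) (V : vectType K) (gr : bigrading V)
    (lam : seq nat) (Hlam : has_shape gr lam)
    (Hnull : contains_minimal_nullroot gr lam) :
  infinite_set (graded_nilpotent_orbits gr).
Proof.
have [mu [delta [_ _ mu_tame [delta_nullroot _] delta_le]]] := Hnull.
have [R [R_ok h_verts /allP le_delta]] := pencil_below_nullroot mu_tame delta_nullroot.
have h_le p : (dimv R p <= \dim (gr p))%N.
  have [->//|/h_verts/le_delta/andP[/delta_le le1 le2]] := posnP (dimv R p).
  by rewrite -lez_nat (le_trans le2 le1).
have [e [c [e_gr c_e c_gr]]] := dual_families h_verts h_le.
have verts_uniq : uniq (verts R) by case/and4P: R_ok.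
pose pair t := (realize (dimv R) (verts R) e c (pencil R t) false,
                realize (dimv R) (verts R) e c (pencil R t) true).
have pair_ok t : graded_nilpotent_pair gr (pair t).
  exact: realize_graded_nilpotent_pair (pencil_square_commutes R_ok h_verts t).
have orbit_inj : injective (fun t => conj_orbit gr (pair t)).
  move=> t s /(intertwines_of_orbit_eq verts_uniq h_verts e_gr c_e c_gr)[x xM x_neq0].
  have [x0|//] := pencil_intertwines R_ok xM.
  (* If [x] vanished at the tip, the entry [1] of the distinguished arrow would have to be zero. *)
  have /and4P[_ _ /and5P[/eqP h_tip /eqP h_base /eqP tip00 _ _] _] := R_ok.
  have := x_neq0 (tip_dir R) (tip R) 0%N 0%N; rewrite h_tip h_base => /(_ isT isT).
  rewrite /pencil tip00 !eqxx addr0 => contra; case/eqP: (oner_neq0 K); apply: contra.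
  by case.
move=> fin; apply: (@closed_field_infinite K).
have := finite_preimage (in2W orbit_inj) fin; apply: sub_finite_set => t _ /=.
by exists (pair t); first exact: pair_ok.
Qed.
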